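(* Let $p\in\Delta_{m-1}$ and $\{p^\nu\}_{\nu\in\mathbb N}\subset\Delta_{m-1}$ with $p^\nu\to p$. For $(u,X)\in\mathbb R^{N_T}\times\mathbb R^n$ let $$f_2(u,X)=-\sum_{j=1}^mp_j\langle S_{T+1}(j),X_T(j^-)\rangle+\iota_{\mathcal X(u)}(X),\qquad f_2^\nu(u,X)=-\sum_{j=1}^mp_j^\nu\langle S_{T+1}(j),X_T(j^-)\rangle+\iota_{\mathcal X(u)}(X).$$ Then $f_2^\nu$ epi-converges to $f_2$.
   Context: Scenario tree. Let $T,k\ge 1$ be integers and consider a finite rooted tree with levels $0,1,\dots,T+1$ (the history tree of a finitely supported discrete-time environment process), in which every node at a level $\le T$ has at least one child. For $0\le t\le T$, $I_t$ is the set of nodes at level $t$ ($I_0$ consists of the root), $n_t=|I_t|$, $N_T=\sum_{t=0}^T n_t$, $n=(k+1)N_T$. The terminal nodes (level $T+1$) are labeled $1,\dots,m$. For a node $i$, $i^-$ is its parent and $i^+$ its set of children. The terminal nodes are partitioned into original scenarios $I$ and added critical scenarios $\tilde I$ (all nodes at levels $\le T$ belong to the original tree). Market. Asset prices are $S_t(i)=(S_t^0,S_t^1(i),\dots,S_t^k(i))\in(0,\infty)^{k+1}$ for each node $i$ at level $t$; asset $0$ is risk-free (its price depends only on $t$). For $j\in\tilde I$ and $1\le i\le k$, $S^i_{T+1}(j)=\kappa_j^iS^i_T(j^-)$ with $\kappa_j^i>0$. The original market is arbitrage-free (no self-financing strategy with zero initial wealth has terminal wealth that is nonnegative a.s. and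 positive with positive probability). The claim is $G_0>0$ and $G_t(i)<0$ for $i\in I_t$, $1\le t\le T$. Probabilities. $\Delta_{m-1}=\{p\in\mathbb R^m_+:\sum_jp_j=1\}$; $p_j$ is the probability of terminal node $j$, with $p_j=0$ for $j\in\tilde I$; $p^\nu$ may charge any scenario. Strategies and perturbed feasible sets. $X\in\mathbb R^n$ is a family $X_t(i)\in\mathbb R^{k+1}$, $i\in I_t$, $0\le t\le T$. A claim perturbation $u\in\mathbb R^{N_T}$ has one component $u_t(i)$ per node $i\in I_t$, $0\le t\le T$. $\mathcal X(u)$ is the set of all $X$ with $X_t(i)\ge0$ componentwise for all $i\in I_t$, $0\le t\le T$; $\langle S_0,X_0\rangle\le G_0+u_0$; and $\langle S_t(i),X_t(i)-X_{t-1}(i^-)\rangle\le G_t(i)+u_t(i)$ for all $i\in I_t$, $1\le t\le T$. $\iota_C$ is the indicator function ($0$ on $C$, $+\infty$ off $C$). Epi-convergence: $g^\nu:\mathbb R^N\to\overline{\mathbb R}$ epi-converges to $g$ if for every $x$: (1) $\liminf_\nu g^\nu(x^\nu)\ge g(x)$ for every $x^\nu\to x$; (2) there is $x^\nu\to x$ with $\limsup_\nu g^\nu(x^\nu)\le g(x)$. *)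

(* Defs.v *)
From HB Require Import structures.
From mathcomp Require Import all_boot all_order all_algebra.
From mathcomp Require Import all_classical all_reals all_analysis.

Set Implicit Arguments.
Unset Strict Implicit.
Unset Printing Implicit Defensive.

Import Order.TTheory GRing.Theory Num.Theory.
Import numFieldNormedType.Exports.

Local Open Scope classical_set_scope.
Local Open Scope ring_scope.

(* The nodes at levels 0, ..., T are numbered by 'I_N, so that N is the total
   number N_T of such nodes (see [card_stages] below); the nodes at level T+1
   are numbered by 'I_m.  [parent root] is a junk value that is never used. *)
Record scenario_tree (T N m : nat) := ScenarioTree {
  level : 'I_N -> nat;
  root : 'I_N;
  parent : 'I_N -> 'I_N;
  tparent : 'I_m -> 'I_N;
  critical : {set 'I_m};
  level_le : forall i, (level i <= T)%N;
  level_eq0 : forall i, (level i == 0%N) = (i == root);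
  level_parent : forall i, i != root -> level i = (level (parent i)).+1;
  level_tparent : forall j, level (tparent j) = T;
  has_child : forall i, (level i < T)%N ->
    exists2 i', i' != root & parent i' = i;
  (* A node at level T belongs to the original tree, so it has a child among
     the original scenarios, not only among the added critical ones. *)
  has_original_child : forall i, level i = T ->
    exists2 j, j \notin critical & tparent j = i
}.

Definition stage (T N m : nat) (tr : scenario_tree T N m) (t : nat) : {set 'I_N} :=
  [set i | level tr i == t]%SET.

Lemma card_stages (T N m : nat) (tr : scenario_tree T N m) :
  N = (\sum_(t < T.+1) #|stage tr t|)%N.
Proof.
have h i : (level tr i < T.+1)%N by rewrite ltnS level_le.
rewrite -[LHS]card_ord -sum1_card.
rewrite (partition_big (fun i => Ordinal (h i)) xpredT) //=.
by apply: eq_bigr => t _; rewrite -sum1_card; apply: eq_bigl => i; rewrite inE.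
Qed.

Record market (R : realType) (T N m k : nat) (tr : scenario_tree T N m) := Market {
  price : 'M[R]_(N, k.+1);
  tprice : 'M[R]_(m, k.+1);
  kappa : 'M[R]_(m, k);
  price_gt0 : forall i a, 0 < price i a;
  tprice_gt0 : forall j a, 0 < tprice j a;
  price_riskfree : forall i i',
    level tr i = level tr i' -> price i ord0 = price i' ord0;
  tprice_riskfree : forall j j', tprice j ord0 = tprice j' ord0;
  kappa_gt0 : forall j a, j \in critical tr -> 0 < kappa j a;
  (* [lift ord0] maps 'I_k onto the risky assets 1, ..., k *)
  tprice_critical : forall j (a : 'I_k), j \in critical tr ->
    tprice j (lift ord0 a) = kappa j a * price (tparent tr j) (lift ord0 a)
}.

Definition dotp (R : realType) (d : nat) (x y : 'rV[R]_d) : R :=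
  \sum_a x ord0 a * y ord0 a.

Definition simplex {R : realType} {m : nat} : set 'rV[R]_m :=
  [set p : 'rV[R]_m | (forall j, 0 <= p ord0 j) /\ \sum_j p ord0 j = 1].

Definition prob (R : realType) (m : nat) (p : 'rV[R]_m) (E : pred 'I_m) : R :=
  \sum_(j | E j) p ord0 j.

Section Strategies.
Context (R : realType) (T N m k : nat).
Context (tr : scenario_tree T N m) (mk : market R k tr).
Implicit Types (X : 'M[R]_(N, k.+1)) (G : 'I_N -> R) (u : 'rV[R]_N) (p : 'rV[R]_m).

Definition initial_cost X : R :=
  dotp (row (root tr) (price mk)) (row (root tr) X).

Definition rebalancing_cost X (i : 'I_N) : R :=
  dotp (row i (price mk)) (row i X - row (parent tr i) X).

Definition terminal_wealth X (j : 'I_m) : R :=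
  dotp (row j (tprice mk)) (row (tparent tr j) X).

Definition self_financing X : Prop :=
  forall i, (0 < level tr i)%N -> rebalancing_cost X i = 0.

(* Short positions are allowed here, unlike in [feasible].  When p vanishes on
   the critical scenarios, only the original market is constrained. *)
Definition arbitrage_free p : Prop :=
  ~ exists X, [/\ initial_cost X = 0, self_financing X,
       prob p (fun j => 0 <= terminal_wealth X j) = 1
     & 0 < prob p (fun j => 0 < terminal_wealth X j)].

Definition is_claim G : Prop :=
  0 < G (root tr) /\ forall i, (0 < level tr i)%N -> G i < 0.

Definition feasible G u : set 'M[R]_(N, k.+1) :=
  [set X : 'M[R]_(N, k.+1) | [/\ forall i a, 0 <= X i a,
     initial_cost X <= G (root tr) + u ord0 (root tr)
   & forall i, (0 < level tr i)%N ->
       rebalancing_cost X i <= G i + u ord0 i]].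

Definition indicator (U : Type) (C : set U) (x : U) : \bar R :=
  if x \in C then 0%E else +oo%E.

Definition f2 G p (uX : 'rV[R]_N * 'M[R]_(N, k.+1)) : \bar R :=
  ((- \sum_j p ord0 j * terminal_wealth uX.2 j)%:E
   + indicator (feasible G uX.1) uX.2)%E.

End Strategies.

Definition epi_converges (R : realType) (V : topologicalType)
    (gn : nat -> V -> \bar R) (g : V -> \bar R) : Prop :=
  forall x : V,
    (forall xn : nat -> V, xn @ \oo --> x ->
       (g x <= limn_einf (fun nu => gn nu (xn nu)))%E) /\
    (exists2 xn : nat -> V, xn @ \oo --> x &
       (limn_esup (fun nu => gn nu (xn nu)) <= g x)%E).

(* Main.v *)
(* The real part (p, X) |-> - \sum_j p_j <S_{T+1}(j), X_T(j^-)> is jointly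
   continuous, and the graph {(u, X) | X \in X(u)} does not depend on nu and is
   closed, being cut out by finitely many weak inequalities between continuous
   functions.  So constant recovery sequences work, and the liminf inequality
   holds at infeasible points because these have infeasible neighbourhoods. *)
Require Import Defs.
From HB Require Import structures.
From mathcomp Require Import all_boot all_order all_algebra.
From mathcomp Require Import all_classical all_reals all_analysis.
Import Order.TTheory GRing.Theory Num.Theory.
Import numFieldNormedType.Exports.
Local Open Scope classical_set_scope.
Local Open Scope ring_scope.

(** The upper limit is the infimum of the suprema over members [A] of [F]. Each [A] may be shrunk to
    its part where [f <= g], still in [F], on which [f] stays below the supremum of [g] over [A]. *)
Lemma le_limf_esup (T : choiceType) (X : filteredType T) (R : realType)
    (f g : X -> \bar R) (F : set_system X) {FF : Filter F} :
  (\forall x \near F, (f x <= g x)%E) -> (limf_esup f F <= limf_esup g F)%E.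
Proof.
move=> fg; apply: le_ereal_inf_tmp => _ [A FA <-].
apply: ge_ereal_inf; exists (ereal_sup (f @` (A `&` [set x | (f x <= g x)%E]))).
  by exists (A `&` [set x | (f x <= g x)%E]) => //; exact: filterI.
apply: ge_ereal_sup => _ [x [Ax fgx] <-]; apply: le_trans fgx _.
by apply: ereal_sup_ubound; exists x.
Qed.

Lemma le_limn_einf (R : realType) (u v : nat -> \bar R) :
  (\forall n \near \oo, (u n <= v n)%E) -> (limn_einf u <= limn_einf v)%E.
Proof.
move=> uv; rewrite /limn_einf leeN2; apply: le_limf_esup.
by apply: filterS uv => n; rewrite /= leeN2.
Qed.

Lemma cvg_sumR (R : realType) (I U : Type) (r : seq I) (F : set_system U)
    {FF : Filter F} (x : I -> U -> R) (x0 : I -> R) :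
  (forall i, x i t @[t --> F] --> x0 i) ->
  \sum_(i <- r) x i t @[t --> F] --> \sum_(i <- r) x0 i.
Proof. by move=> xx0; apply: cvg_big => [|i _]; [exact: add_continuous|]. Qed.

(** Convergence is asked coordinate by coordinate, so that for rows of a matrix it reduces to
    continuity of the matrix entries. *)
Lemma cvg_dotp (R : realType) (d : nat) (U : Type) (F : set_system U)
    {FF : Filter F} (c : 'rV[R]_d) (x : U -> 'rV[R]_d) (x0 : 'rV[R]_d) :
  (forall a, x t ord0 a @[t --> F] --> x0 ord0 a) ->
  dotp c (x t) @[t --> F] --> dotp c x0.
Proof.
by move=> xx0; apply: cvg_sumR => a; apply: cvgM => //; exact: cvg_cst.
Qed.

Section Continuity.
Context (R : realType) (T N m k : nat).
Context (tr : scenario_tree T N m) (mk : market R k tr).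
Implicit Types (i : 'I_N) (j : 'I_m).

Lemma initial_cost_continuous : continuous (initial_cost mk).
Proof.
move=> X; apply: (cvg_dotp _ _ _ (nbhs X)) => a; under eq_fun do rewrite mxE.
by rewrite mxE; exact: coord_continuous.
Qed.

Lemma rebalancing_cost_continuous i : continuous (rebalancing_cost mk ^~ i).
Proof.
move=> X; apply: (cvg_dotp _ _ _ (nbhs X)) => a; under eq_fun do rewrite !mxE.
by rewrite !mxE; apply: cvgB; exact: coord_continuous.
Qed.

Lemma terminal_wealth_continuous j : continuous (terminal_wealth mk ^~ j).
Proof.
move=> X; apply: (cvg_dotp _ _ _ (nbhs X)) => a; under eq_fun do rewrite mxE.
by rewrite mxE; exact: coord_continuous.
Qed.

(** Closedness is needed jointly in [(u, X)], because both components move along the sequences of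
    epi-convergence. *)
Lemma feasible_closed (G : 'I_N -> R) :
  closed [set uX : 'rV[R]_N * 'M[R]_(N, k.+1) | feasible mk G uX.1 uX.2].
Proof.
(* The slack of the budget constraint at node [i] with cost [g]; it covers the initial and the
   rebalancing constraints alike, and turns each into the preimage of the closed half-line of
   nonnegative reals. *)
pose slack (g : 'M[R]_(N, k.+1) -> R) i (uX : 'rV[R]_N * 'M[R]_(N, k.+1)) :=
  G i + uX.1 ord0 i - g uX.2.
have slack_closed g i : continuous g -> closed [set uX | 0 <= slack g i uX].
  move=> gc; apply: preimage_closed (@closed_ge R 0) => uX _.
  apply: cvgB; last exact: (continuous_comp cvg_snd (gc _)).
  apply: cvgD; first exact: cvg_cst.
  exact: (continuous_comp cvg_fst (@coord_continuous R _ _ ord0 i _)).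
rewrite (_ : [set _ | _] =
    \bigcap_(ia in [set: 'I_N * 'I_k.+1])
      [set uX : 'rV[R]_N * 'M[R]_(N, k.+1) | 0 <= uX.2 ia.1 ia.2]
    `&` ([set uX | 0 <= slack (initial_cost mk) (Defs.root tr) uX]
    `&` \bigcap_(i in [set i | (0 < level tr i)%N])
          [set uX | 0 <= slack (rebalancing_cost mk ^~ i) i uX])).
  apply: closedI; first apply: closed_bigI => -[i a] _.
    apply: preimage_closed (@closed_ge R 0) => uX _.
    exact: (continuous_comp cvg_snd (@coord_continuous R _ _ i a _)).
  apply: closedI; first exact/slack_closed/initial_cost_continuous.
  by apply: closed_bigI => i _; exact/slack_closed/rebalancing_cost_continuous.
apply/seteqP; split=> -[u X] /=.
  move=> [X0 c0 ci]; split=> [[i a] _|]; first exact: X0.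
  by split=> [|i /ci]; rewrite /slack /= subr_ge0.
move=> [X0 [c0 ci]]; split=> [i a||i li]; first exact: (X0 (i, a)).
  by rewrite -subr_ge0.
by rewrite -subr_ge0; exact: ci.
Qed.

(** Probabilities and strategies vary together: each summand is a product of two convergent factors,
    and the sum is finite. *)
Lemma cvg_expected_wealth (U : Type) (F : set_system U) {FF : Filter F}
    (q : U -> 'rV[R]_m) (p : 'rV[R]_m)
    (Y : U -> 'M[R]_(N, k.+1)) (X : 'M[R]_(N, k.+1)) :
  q @ F --> p -> Y @ F --> X ->
  \sum_j q t ord0 j * terminal_wealth mk (Y t) j @[t --> F] -->
  \sum_j p ord0 j * terminal_wealth mk X j.
Proof.
move=> qp YX; apply: cvg_sumR => j; apply: cvgM.
  exact: (cvg_comp _ _ qp (@coord_continuous R _ _ ord0 j p)).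
exact: (cvg_comp _ _ YX (@terminal_wealth_continuous j X)).
Qed.

End Continuity.

Theorem proposition3p5 (R : realType) (T N m k : nat)
    (hT : (1 <= T)%N) (hk : (1 <= k)%N)
    (tr : scenario_tree T N m) (mk : market R k tr)
    (G : 'I_N -> R) (hG : is_claim tr G)
    (p : 'rV[R]_m) (hp : simplex p)
    (hpcrit : forall j, j \in critical tr -> p ord0 j = 0)
    (harb : arbitrage_free mk p)
    (pn : nat -> 'rV[R]_m) (hpn : forall nu, simplex (pn nu))
    (hcvg : pn @ \oo --> p) :
  epi_converges (fun nu => f2 mk G (pn nu)) (f2 mk G p).
Proof.
have f2T q uX : feasible mk G uX.1 uX.2 ->
    f2 mk G q uX = (- \sum_j q ord0 j * terminal_wealth mk uX.2 j)%:E.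
  by move=> fX; rewrite /f2 /indicator mem_set// adde0.
have f2F q uX : ~ feasible mk G uX.1 uX.2 -> f2 mk G q uX = +oo%E.
  by move=> nfX; rewrite /f2 /indicator memNset// addey.
(* The real part converges along every convergent sequence, feasible or not; this serves both
   epi-convergence conditions. *)
have cvg_real (xn : nat -> 'rV[R]_N * 'M[R]_(N, k.+1))
    (x : 'rV[R]_N * 'M[R]_(N, k.+1)) : xn @ \oo --> x ->
    (- \sum_j pn n ord0 j * terminal_wealth mk (xn n).2 j)%:E @[n --> \oo] -->
    (- \sum_j p ord0 j * terminal_wealth mk x.2 j)%:E.
  move=> xnx; apply: cvg_EFin; first exact: nearW.
  apply: cvgN; apply: cvg_expected_wealth => //.
  exact: (cvg_comp _ _ xnx cvg_snd).
move=> x; split=> [xn xnx|]; last first.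
  exists (fun=> x); first exact: cvg_cst.
  (* At an infeasible point the upper bound is [+oo], so nothing is to be shown. *)
  have [fx|nfx] := pselect (feasible mk G x.1 x.2); last by rewrite f2F ?leey.
  rewrite f2T//; under eq_fun do rewrite f2T//.
  by rewrite (cvg_limn_einf_sup (cvg_real (fun=> x) x (cvg_cst _))).2.
have [fx|nfx] := pselect (feasible mk G x.1 x.2).
  (* Terms [xn n] may be infeasible even if [x] is feasible, but the indicator only raises the value
     above the real part, whose lower limit is the value at [x]. *)
  rewrite f2T// -(cvg_limn_einf_sup (cvg_real _ _ xnx)).1.
  apply: le_limn_einf; apply: nearW => n.
  have [fxn|nfxn] := pselect (feasible mk G (xn n).1 (xn n).2).
    by rewrite f2T.
  by rewrite f2F ?leey.
(* The value [+oo] is written as the lower limit of a constant sequence, to be compared termwise. *)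
rewrite f2F// -(cvg_limn_einf_sup (@cvg_cst _ +oo%E nat \oo _)).1.
apply: le_limn_einf.
have openC := closed_openC (feasible_closed _ _ _ _ _ _ mk G).
(* The infeasible pairs form an open neighbourhood of [x], so [xn] eventually stays among them and
   the values are eventually [+oo]. *)
have /xnx := open_nbhs_nbhs (conj openC nfx).
by apply: (filterS (F := \oo)) => n nfxn; rewrite f2F.
Qed.
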